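(* Let $F_1(x)=1,\ F_2(x)=x,\ F_3(x),\ldots$ be the Fibonacci polynomials. Then for every natural number $n\ge 1$, \[F_{n+1}(x)= \left|\begin{array}{rrrrrr} x&1&0&\cdots&0&0\\ -1&x&1&\cdots&0&0\\ 0&-1&x&\cdots&0&0\\ \vdots&\vdots&\vdots&\ddots&\vdots&\vdots\\ 0&0&0&\cdots&x&1\\ 0&0&0&\cdots&-1&x\end{array}\right|,\] where the determinant has size $n$; that is, the matrix is the $n\times n$ tridiagonal matrix with all diagonal entries equal to $x$, all superdiagonal entries equal to $1$, and all subdiagonal entries equal to $-1$.
   Context: The Fibonacci polynomials are defined by $F_1(x)=1$, $F_2(x)=x$, and $F_{k+1}(x)=F_{k-1}(x)+xF_k(x)$ for $k\ge 2$. *)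

(* Defs.v *)
From mathcomp Require Import all_boot all_algebra.

Set Implicit Arguments.
Unset Strict Implicit.
Unset Printing Implicit Defensive.

Import GRing.Theory.
Local Open Scope ring_scope.

(* The sequence is only meant for indices k >= 1; the value at 0 is a dummy
   (it is the one that makes the recurrence also hold at k = 1). *)
Fixpoint fibonacci_poly (R : comNzRingType) (k : nat) : {poly R} :=
  match k with
  | 0 => 0
  | 1 => 1
  | 2 => 'X
  | S (S (S _ as k1) as k2) => fibonacci_poly R k1 + 'X * fibonacci_poly R k2
  end.

Fact fibonacci_poly1 (R : comNzRingType) : fibonacci_poly R 1 = 1.
Proof. by []. Qed.

Fact fibonacci_poly2 (R : comNzRingType) : fibonacci_poly R 2 = 'X.
Proof. by []. Qed.

Fact fibonacci_polyS (R : comNzRingType) (k : nat) : (2 <= k)%N ->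
  fibonacci_poly R k.+1 = fibonacci_poly R k.-1 + 'X * fibonacci_poly R k.
Proof. by case: k => [|[|k]]. Qed.

Definition fibonacci_mx (R : comNzRingType) (n : nat) : 'M[{poly R}]_n :=
  \matrix_(i < n, j < n)
    if i == j :> nat then 'X
    else if j == i.+1 :> nat then 1
    else if i == j.+1 :> nat then -1
    else 0.

(* Main.v *)
Require Import Defs.
From mathcomp Require Import all_boot all_algebra.

Import GRing.Theory.
Local Open Scope ring_scope.

(** The determinants of these tridiagonal matrices form a continuant: expanding
    along the first row leaves two minors, the matrix of the next smaller size
    and one whose first column is [-1, 0, ..., 0], which collapses to the size
    below that.  The off-diagonal product [1 * -1] turns the usual minus sign
    of the continuant recurrence into a plus, so the determinants satisfy the
    Fibonacci recurrence ([det_fibonacci_mxSS]); the two sequences agree at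
    sizes 0 and 1. *)

(** The entries depend only on the difference of the indices, so the trailing
    principal submatrix is again of the same family. *)
Lemma fibonacci_mx_minor00 (R : comNzRingType) (n : nat) :
  row' ord0 (col' ord0 (fibonacci_mx R n.+1)) = fibonacci_mx R n.
Proof. by apply/matrixP=> i j; rewrite !mxE. Qed.

(** In the minor at (0, 1) only the subdiagonal entry of row 1 survives in the
    first column; removing its row and column as well leaves the trailing
    principal submatrix of size [n]. *)
Lemma det_fibonacci_mx_minor01 (R : comNzRingType) (n : nat) :
  \det (row' ord0 (col' (lift ord0 ord0) (fibonacci_mx R n.+2)))
    = - \det (fibonacci_mx R n).
Proof.
rewrite (expand_det_col _ ord0) big_ord_recl big1 ?addr0 => [|i _]; last first.
  by rewrite !mxE /= mul0r.
rewrite !mxE /= mulN1r /cofactor expr0 mul1r; congr (- \det _).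
by apply/matrixP=> i j; rewrite !mxE.
Qed.

Lemma det_fibonacci_mxSS (R : comNzRingType) (n : nat) :
  \det (fibonacci_mx R n.+2)
    = \det (fibonacci_mx R n) + 'X * \det (fibonacci_mx R n.+1).
Proof.
rewrite (expand_det_row _ ord0) !big_ord_recl big1 ?addr0 => [|i _]; last first.
  by rewrite !mxE /= mul0r.
rewrite /cofactor fibonacci_mx_minor00 det_fibonacci_mx_minor01 !mxE /=.
by rewrite expr0 !mul1r expr1 mulN1r opprK addrC.
Qed.

(** Size 0 is included because the recurrence reaches back two steps; there the
    empty determinant 1 matches the first Fibonacci polynomial. *)
Lemma fibonacci_poly_det (R : comNzRingType) (n : nat) :
  fibonacci_poly R n.+1 = \det (fibonacci_mx R n).
Proof.
elim/ltn_ind: n => -[|[|n]] IHn.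
- by rewrite det_mx00.
- by rewrite det_mx11 mxE.
by rewrite fibonacci_polyS // det_fibonacci_mxSS -!IHn.
Qed.

Theorem proposition2p3 (R : comNzRingType) (n : nat) (hn : (1 <= n)%N) :
  fibonacci_poly R n.+1 = \det (fibonacci_mx R n).
Proof. exact: fibonacci_poly_det. Qed.
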